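(* Consider the system $$\dot x=f(x,t,p(t/\alpha)),\qquad x\in\mathbb{R}^n, \tag{S}$$ where $f:\mathbb{R}^n\times[0,\infty)\times\mathbb{R}^d\to\mathbb{R}^n$, $\alpha>0$ is a constant, and $p:\mathbb{R}\to\mathbb{R}^d$ is bounded and its components $p_1,\ldots,p_d$ have bounded first derivatives. Put $\bar p:=\sup\{|p'(r)|:r\in\mathbb{R}\}$, where $p'(r)=(p_1'(r),\ldots,p_d'(r))$, and $\mathcal{R}(p):=\{p(t):t\in\mathbb{R}\}$. Suppose there exist $\alpha_1,\alpha_2\in\mathcal{K}_\infty$, positive constants $c_a,c_b,T$, a continuous function $q:\mathbb{R}^d\to\mathbb{R}$, and a $C^1$ function $V:\mathbb{R}^n\times[0,\infty)\times\mathbb{R}^d\to[0,\infty)$ such that, for all $x\in\mathbb{R}^n$, $t\ge0$ and $\tau\in\mathcal{R}(p)$: 1. $\alpha_1(|x|)\le V(x,t,\tau)\le\alpha_2(|x|)$; 2. $V_t(x,t,\tau)+V_x(x,t,\tau)f(x,t,\tau)\le -q(\tau)V(x,t,\tau)$; 3. $|V_\tau(x,t,\tau)|\le c_aV(x,t,\tau)$; 4. $\int_{t-T}^tq(p(s))\,ds\ge c_b$. Then for each constant $\alpha>0$ with $\alpha>2Tc_a\bar p/c_b$, the system (S) is UGAS and $$V^\sharp_\alpha(x,t):=\exp\left(\frac{\alpha}{T}\int_{\frac t\alpha-T}^{\frac t\alpha}\int_s^{\frac t\alpha}q(p(l))\,dl\,ds\right)V(x,t,p(t/\alpha))$$ is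 a Lyapunov function for (S).
   Context: $|\cdot|$ is the Euclidean norm; subscripts on functions denote partial gradients. $C^1$ means continuously differentiable (one-sided at the endpoint $t=0$ of $[0,\infty)$). $\mathcal{K}_\infty$: continuous, strictly increasing, unbounded functions $\rho:[0,\infty)\to[0,\infty)$ with $\rho(0)=0$. $\mathcal{KL}$: continuous functions $\beta:[0,\infty)\times[0,\infty)\to[0,\infty)$ such that $\beta(\cdot,t)\in\mathcal{K}_\infty$ for each $t\ge0$, $\beta(s,\cdot)$ is non-increasing for each $s\ge0$, and $\beta(s,t)\to0$ as $t\to+\infty$ for each $s\ge 0$. A continuous function $\rho:[0,\infty)\to[0,\infty)$ is positive definite if it is zero only at zero. For a system $\dot x=h(x,t)$ on $\mathbb{R}^n$, $t\ge 0$: - It is forward complete if for each $x_o\in\mathbb{R}^n$, $t_o\ge0$ there is a unique trajectory $t\mapsto\phi(t;t_o,x_o)$ defined on $[t_o,\infty)$ with value $x_o$ at $t_o$. - It is UGAS (uniformly globally asymptotically stable) if there is $\beta\in\mathcal{KL}$ with $|\phi(t;t_o,x_o)|\le\beta(|x_o|,t-t_o)$ for all $x_o\in\mathbb{R}^n$, $t_o\ge0$, $t\ge t_o$. - A Lyapunov function for it is a $C^1$ function $W:\mathbb{R}^n\times[0,\infty)\to[0,\infty)$ for which there are $\alpha_1,\alpha_2\in\mathcal{K}_\infty$ and a positive definite $\alpha_3$ such that $\alpha_1(|x|)\le W(x,t)\le\alpha_2(|x|)$ and $W_t(x,t)+W_x(x,t)h(x,t)\le-\alpha_3(|x|)$ for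 all $t\ge0$, $x\in\mathbb{R}^n$. Standing assumptions: for $h(x,t)=f(x,t,p(t/\alpha))$ (every $\alpha>0$) and $h(x,t)=f(x,t,\tau)$ (every $\tau\in\mathcal{R}(p)$), $h$ is locally Lipschitz, $\dot x=h(x,t)$ is forward complete, and there is $\alpha_h\in\mathcal{K}_\infty$ with $|h(x,t)|\le\alpha_h(|x|)$ for all $x,t$.
   Formalization: The conclusion that V^sharp is a Lyapunov function is proved only when p' is continuous, since otherwise V^sharp need not be C^1 (e.g. f=-x, V=x^2 e^tau, p(r)=r^2 sin(1/r) near 0); UGAS is proved without this assumption. *)

(* Defs.v *)
From HB Require Import structures.
From mathcomp Require Import all_boot all_order all_algebra.
From mathcomp Require Import all_classical all_reals all_analysis.

Set Implicit Arguments.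
Unset Strict Implicit.
Unset Printing Implicit Defensive.
Import Order.TTheory GRing.Theory Num.Theory.
Import numFieldNormedType.Exports.
Local Open Scope classical_set_scope.
Local Open Scope ring_scope.

(* Functions whose mathematical time domain is [0, +oo[ are represented by
   total functions of t : R; every condition below only looks at t >= 0. *)

(* The Euclidean norm; the library norm `|v| on 'rV[R]_n is the sup norm. *)
Definition enorm (R : realType) (n : nat) (v : 'rV[R]_n) : R :=
  Num.sqrt (\sum_(i < n) v 0 i ^+ 2).

Definition dotv (R : realType) (n : nat) (u v : 'rV[R]_n) : R :=
  \sum_(i < n) u 0 i * v 0 i.

Section Derivatives.
Context {R : realType}.

(* Derivative at t >= a of a function on [a, +oo[: two-sided when a < t,
   from the right when t = a. *)
Definition quotient_from (W : normedModType R) (a : R) (g : R -> W) (t : R) :=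
  (fun s => (s - t)^-1 *: (g s - g t)) @ within `[a, +oo[ t^'.

Definition derivable_from (W : normedModType R) (a : R) (g : R -> W) (t : R) :=
  cvg (quotient_from a g t).

Definition derive_from (W : normedModType R) (a : R) (g : R -> W) (t : R) : W :=
  lim (quotient_from a g t).

Definition has_derive_from (W : normedModType R) (a : R) (g : R -> W) (t : R)
    (l : W) :=
  quotient_from a g t --> l.

Definition has_partials (n : nat) (g : 'rV[R]_n -> R) (x : 'rV[R]_n) :=
  forall i : 'I_n, derivable g x (delta_mx 0 i).

Definition grad (n : nat) (g : 'rV[R]_n -> R) (x : 'rV[R]_n) : 'rV[R]_n :=
  \row_(i < n) 'D_(delta_mx 0 i) g x.

Definition curve_deriv (d : nat) (p : R -> 'rV[R]_d) (r : R) : 'rV[R]_d :=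
  \row_(i < d) derive1 (fun s => p s 0 i) r.

End Derivatives.

Section PartialGradients.
Context {R : realType} {n d : nat}.

Definition partial_x (V : 'rV[R]_n -> R -> 'rV[R]_d -> R) x t tau : 'rV[R]_n :=
  grad (fun y => V y t tau) x.
Definition partial_t (V : 'rV[R]_n -> R -> 'rV[R]_d -> R) x t tau : R :=
  derive_from 0 (fun s => V x s tau) t.
Definition partial_tau (V : 'rV[R]_n -> R -> 'rV[R]_d -> R) x t tau : 'rV[R]_d :=
  grad (fun sigma => V x t sigma) tau.

(* C^1 on R^n x [0, +oo[ x R^d: all partials exist (one-sided in t at t = 0)
   and are jointly continuous up to the boundary t = 0. *)
Definition C1_xttau (V : 'rV[R]_n -> R -> 'rV[R]_d -> R) :=
  let D := [set z : 'rV[R]_n * R * 'rV[R]_d | 0 <= z.1.2] in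
  [/\ forall x (t : R) tau, 0 <= t ->
        [/\ has_partials (fun y => V y t tau) x,
            derivable_from 0 (fun s => V x s tau) t &
            has_partials (fun sigma => V x t sigma) tau],
      {within D, continuous (fun z => partial_x V z.1.1 z.1.2 z.2)},
      {within D, continuous (fun z => partial_t V z.1.1 z.1.2 z.2)} &
      {within D, continuous (fun z => partial_tau V z.1.1 z.1.2 z.2)}].

Definition grad_x (W : 'rV[R]_n -> R -> R) x t : 'rV[R]_n :=
  grad (fun y => W y t) x.
Definition deriv_t (W : 'rV[R]_n -> R -> R) x t : R :=
  derive_from 0 (fun s => W x s) t.

(* C^1 on R^n x [0, +oo[. *)
Definition C1_xt (W : 'rV[R]_n -> R -> R) :=
  let D := [set z : 'rV[R]_n * R | 0 <= z.2] in
  [/\ forall x (t : R), 0 <= t ->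
        has_partials (fun y => W y t) x /\
        derivable_from 0 (fun s => W x s) t,
      {within D, continuous (fun z => grad_x W z.1 z.2)} &
      {within D, continuous (fun z => deriv_t W z.1 z.2)}].

End PartialGradients.

Section ComparisonFunctions.
Context {R : realType}.

(* Nonnegativity on [0, +oo[ follows from rho 0 = 0 and monotonicity. *)
Definition Kinfty (rho : R -> R) :=
  [/\ {within `[0, +oo[, continuous rho},
      forall s r : R, 0 <= s -> s < r -> rho s < rho r,
      forall M : R, exists2 s, 0 <= s & M <= rho s &
      rho 0 = 0].

Definition KL (beta : R -> R -> R) :=
  [/\ {within [set z : R * R | 0 <= z.1 /\ 0 <= z.2],
        continuous (fun z => beta z.1 z.2)},
      forall t : R, 0 <= t -> Kinfty (beta ^~ t),
      forall s t u : R, 0 <= s -> 0 <= t -> t <= u -> beta s u <= beta s t &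
      forall s : R, 0 <= s -> beta s t @[t --> +oo] --> (0 : R)].

Definition posdef (rho : R -> R) :=
  [/\ {within `[0, +oo[, continuous rho},
      forall s : R, 0 <= s -> 0 <= rho s &
      forall s : R, 0 <= s -> (rho s = 0 <-> s = 0)].

End ComparisonFunctions.

Section Systems.
Context {R : realType} {n : nat}.
Implicit Types (h : 'rV[R]_n -> R -> 'rV[R]_n) (phi : R -> 'rV[R]_n).

Definition trajectory h (t0 : R) (x0 : 'rV[R]_n) phi :=
  phi t0 = x0 /\
  forall t, t0 <= t -> has_derive_from t0 phi t (h (phi t) t).

Definition forward_complete h :=
  forall (x0 : 'rV[R]_n) (t0 : R), 0 <= t0 ->
  exists2 phi, trajectory h t0 x0 phi &
    forall psi, trajectory h t0 x0 psi -> forall t, t0 <= t -> psi t = phi t.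

(* The trajectory phi(.; t0, x0) is referred to by quantifying over all
   trajectories; there is exactly one on [t0, +oo[ under forward_complete. *)
Definition UGAS h :=
  exists2 beta : R -> R -> R, KL beta &
    forall (x0 : 'rV[R]_n) (t0 : R) phi, 0 <= t0 -> trajectory h t0 x0 phi ->
    forall t, t0 <= t -> enorm (phi t) <= beta (enorm x0) (t - t0).

Definition Lyapunov h (W : 'rV[R]_n -> R -> R) :=
  [/\ C1_xt W,
      forall x (t : R), 0 <= t -> 0 <= W x t &
      exists alpha1 alpha2 alpha3 : R -> R,
        [/\ Kinfty alpha1, Kinfty alpha2, posdef alpha3 &
            forall x (t : R), 0 <= t ->
              alpha1 (enorm x) <= W x t <= alpha2 (enorm x) /\
              deriv_t W x t + dotv (grad_x W x t) (h x t)
                <= - alpha3 (enorm x)]].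

(* Joint local Lipschitz continuity on R^n x [0, +oo[; the norm on the product
   is the maximum of the sup norms, which is equivalent to the Euclidean one. *)
Definition locally_lipschitz h :=
  forall z : 'rV[R]_n * R, 0 <= z.2 ->
  exists2 U : set ('rV[R]_n * R), nbhs z U &
    [lipschitz h w.1 w.2 | w in U `&` [set w | 0 <= w.2]].

Definition standing h :=
  [/\ locally_lipschitz h, forward_complete h &
      exists2 alphah : R -> R, Kinfty alphah &
        forall x (t : R), 0 <= t -> enorm (h x t) <= alphah (enorm x)].

End Systems.

(* When V depends on tau, the t-partial of Vsharp involves p', so Vsharp need
   not be C^1 unless p' is continuous. *)
Definition Vsharp (R : realType) (n d : nat) (p : R -> 'rV[R]_d)
    (q : 'rV[R]_d -> R) (V : 'rV[R]_n -> R -> 'rV[R]_d -> R) (T alpha : R)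
    (x : 'rV[R]_n) (t : R) : R :=
  expR (alpha / T *
    \int[@lebesgue_measure R]_(s in `[t / alpha - T, t / alpha])
      \int[@lebesgue_measure R]_(l in `[s, t / alpha]) q (p l))
  * V x t (p (t / alpha)).

(* Main.v *)
(* Along a trajectory, V(x(t), t, p(t/alpha)) grows at a rate of at most
   -q(p(t/alpha)) + ca pbar / alpha, which may be positive at times; only the
   mean of q over windows of length T is known to be positive. If Q' = g with
   g = q o p, the double integral in Vsharp is
   int_(u-T)^u (Q(u) - Q(s)) ds, whose derivative in u is
   T g(u) - int_(u-T)^u g. The exponential factor therefore contributes
   g(t/alpha) - (1/T) int_(t/alpha-T)^(t/alpha) g to the logarithmic derivative,
   replacing -q by minus its window mean, which is at most -cb/T. Since
   ca pbar / alpha < cb / (2T), Vsharp decays at rate cb / (2T). The exponent is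
   bounded because q o p is, so Vsharp and V are equivalent, and decay of Vsharp
   gives the KL bound alpha1^-1(C exp(-c t) alpha2(s)). *)
Require Import Defs.
From mathcomp Require Import all_boot all_order all_algebra.
From mathcomp Require Import all_classical all_reals all_analysis.
From mathcomp Require Import ring lra.
Import Order.TTheory GRing.Theory Num.Theory.
Import numFieldNormedType.Exports.
Local Open Scope classical_set_scope.
Local Open Scope ring_scope.
Set Implicit Arguments.
Unset Strict Implicit.
Unset Printing Implicit Defensive.

(** * One-sided derivatives *)

Section OneSidedDerivative.
Context {R : realType} {W : normedModType R}.
Implicit Types (a t : R) (g : R -> W) (l : W).

(** Points slightly to the right of [t] lie in the ray, even when [t = a]. Properness is what makes
    the one-sided derivative unique. *)
Lemma from_dnbhs_properfilter a t : a <= t -> ProperFilter (within `[a, +oo[ t^').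
Proof.
move=> at_; have F : Filter (within `[a, +oo[ t^').
  by apply: within_filter; exact: dnbhs_filter.
apply: Build_ProperFilter_ex => A /=.
rewrite /within /= /dnbhs /within /= => /nbhs_ballP[e /= e0 H].
exists (t + e / 2); apply: (H (t + e / 2)).
- by rewrite /ball /= opprD addrA subrr sub0r normrN gtr0_norm; lra.
- by rewrite gt_eqF//; lra.
- by rewrite /= in_itv /= andbT; lra.
Qed.

Lemma quotient_dist g (s t : R) l : s != t ->
  `|g s - g t - (s - t) *: l| = `|s - t| * `|l - (s - t)^-1 *: (g s - g t)|.
Proof.
move=> st; have st0 : s - t != 0 by rewrite subr_eq0.
by rewrite distrC -normrZ scalerBr scalerA mulfV// scale1r.
Qed.

(** Multiplying the quotient out removes the exclusion of [s = t] and leaves a linear error bound,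
    the form in which the later estimates are combined. *)
Lemma has_derive_fromP a g t l : has_derive_from a g t l <->
  forall e, 0 < e -> exists2 dl, 0 < dl & forall s, a <= s -> `|s - t| < dl ->
    `|g s - g t - (s - t) *: l| <= e * `|s - t|.
Proof.
rewrite /has_derive_from /quotient_from.
have F : Filter (within `[a, +oo[ t^').
  by apply: within_filter; exact: dnbhs_filter.
split=> [/cvgrPdist_le H e e0|H].
  have := H e e0; rewrite /within /= /dnbhs /within /= => /nbhs_ballP[dl /= dl0 K].
  exists dl => // s as_ st; have [->|nst] := eqVneq s t.
    by rewrite !subrr scale0r subr0 !normr0 mulr0.
  have := K s; rewrite /ball /= distrC => /(_ st nst).
  rewrite in_itv /= andbT => /(_ as_).
  by rewrite quotient_dist// mulrC => h; apply: ler_wpM2r.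
apply/cvgrPdist_le => e e0; have [dl dl0 K] := H e e0.
rewrite /within /= /dnbhs /within /=; apply/nbhs_ballP; exists dl => // s /=.
rewrite /ball /= distrC => st nst; rewrite in_itv /= andbT => as_.
have := K s as_ st; rewrite quotient_dist// mulrC ler_pM2r//.
by rewrite normr_gt0 subr_eq0.
Qed.

Lemma has_derive_from_unique a g t l : a <= t -> has_derive_from a g t l ->
  derive_from a g t = l.
Proof.
move=> at_; rewrite /has_derive_from /derive_from.
by have F := from_dnbhs_properfilter at_; exact: cvg_lim.
Qed.

(** [cvg F] unfolds to [F --> lim F]. *)
Lemma derivable_fromP a g t : derivable_from a g t ->
  has_derive_from a g t (derive_from a g t).
Proof. by []. Qed.

Lemma has_derive_from_derivable a g t l :
  has_derive_from a g t l -> derivable_from a g t.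
Proof. by move=> h; apply/cvg_ex; exists l. Qed.

Lemma has_derive_from_cvg a g t l : has_derive_from a g t l ->
  g @ within `[a, +oo[ (nbhs t) --> g t.
Proof.
move=> /has_derive_fromP/(_ 1 ltr01)[dl dl0 H].
have F : Filter (within `[a, +oo[ (nbhs t)) by exact: within_filter.
apply/cvgrPdist_lt => e e0.
have c0 : 0 < 1 + `|l| by rewrite ltr_wpDr.
(* With error constant 1 the increment of [g] is at most [(1 + |l|) * |s - t|], hence this
   radius. *)
rewrite /within /=; apply/nbhs_ballP; exists (Num.min dl (e / (1 + `|l|))) => /=.
  by rewrite lt_min dl0 divr_gt0.
move=> s; rewrite /ball /= distrC lt_min => /andP[s1 s2].
rewrite in_itv /= andbT => as_; rewrite distrC.
move: s2; rewrite ltr_pdivlMr// => s2.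
apply: le_lt_trans s2; rewrite mulrDr mulr1.
have := H s as_ s1; rewrite mul1r -normrZ => h.
rewrite -[g s - g t](subrK ((s - t) *: l)).
by apply: (le_trans (ler_normD _ _)); rewrite lerD2r.
Qed.

Lemma has_derive_from_widen a b g t l : a <= b ->
  has_derive_from a g t l -> has_derive_from b g t l.
Proof.
move=> ab /has_derive_fromP H; apply/has_derive_fromP => e /H[dl dl0 K].
by exists dl => // s bs; apply: K; exact: le_trans bs.
Qed.
End OneSidedDerivative.

Section ScalarDerivative.
Context {R : realType}.
Implicit Types (g : R -> R) (a t l : R).

Lemma is_deriveP g t l : is_derive t 1 g l <->
  forall e, 0 < e -> exists2 dl, 0 < dl & forall s, `|s - t| < dl ->
    `|g s - g t - (s - t) *: l| <= e * `|s - t|.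
Proof.
split=> [[dg gl] e e0|H].
  have : (fun h => h^-1 *: (g (h *: 1 + t) - g t)) @ 0^' --> l.
    by rewrite -gl; exact: dg.
  move=> /cvgrPdist_le/(_ e e0); rewrite /dnbhs /within /= => /nbhs_ballP[dl /= dl0 K].
  exists dl => // s st; have [->|nst] := eqVneq s t.
    by rewrite !subrr scale0r subr0 !normr0 mulr0.
  have := K (s - t); rewrite /ball /= sub0r normrN => /(_ st).
  rewrite subr_eq0 => /(_ nst); rewrite [(s - t) *: 1]mulr1 subrK => h.
  by rewrite (quotient_dist _ _ nst) mulrC; apply: ler_wpM2r.
have : (fun h => h^-1 *: (g (h *: 1 + t) - g t)) @ 0^' --> l.
  apply/cvgrPdist_le => e e0; have [dl dl0 K] := H e e0.
  rewrite /dnbhs /within /=; apply/nbhs_ballP; exists dl => // s /=.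
  rewrite /ball /= sub0r normrN => st ns0.
  have := K (s + t); rewrite addrK => /(_ st).
  have nst : s + t != t by rewrite -subr_eq0 addrK.
  have := @quotient_dist _ _ g _ _ l nst; rewrite addrK => ->.
  by rewrite [s *: 1]mulr1 mulrC ler_pM2r// normr_gt0.
move=> h; apply: DeriveDef; first by apply/cvg_ex; exists l.
by rewrite /derive; exact: (cvg_lim (@norm_hausdorff _ _) h).
Qed.

Lemma has_derive_from_interior a g t l : a < t ->
  has_derive_from a g t l -> is_derive t 1 g l.
Proof.
move=> at_ /has_derive_fromP H; apply/is_deriveP => e /H[dl dl0 K].
exists (Num.min dl (t - a)); first by rewrite lt_min dl0 subr_gt0.
move=> s; rewrite lt_min => /andP[s1]; rewrite ltr_norml => /andP[s2 _].
by apply: K => //; lra.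
Qed.

Lemma is_derive_has_derive_from a g t l :
  is_derive t 1 g l -> has_derive_from a g t l.
Proof.
move=> /is_deriveP H; apply/has_derive_fromP => e /H[dl dl0 K].
by exists dl => // s _; exact: K.
Qed.

Lemma has_derive_fromM a g1 g2 t l1 l2 :
  has_derive_from a g1 t l1 -> has_derive_from a g2 t l2 ->
  has_derive_from a (fun s => g1 s * g2 s) t (l1 * g2 t + g1 t * l2).
Proof.
move=> h1 h2; rewrite /has_derive_from /quotient_from.
have F : Filter (within `[a, +oo[ t^').
  by apply: within_filter; exact: dnbhs_filter.
(* The product increment is split with [g2] frozen at [t] and [g1] moving, so a limit of [g1] itself
   is required. *)
have -> : (fun s => (s - t)^-1 *: (g1 s * g2 s - g1 t * g2 t)) =
  (fun s => ((s - t)^-1 *: (g1 s - g1 t)) * g2 t +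
             g1 s * ((s - t)^-1 *: (g2 s - g2 t))).
  by apply/funext => s; rewrite /GRing.scale /=; ring.
apply: cvgD; first by apply: cvgM; [exact: h1|exact: cvg_cst].
apply: cvgM; last exact: h2.
apply: cvg_trans (has_derive_from_cvg h1).
apply: cvg_app => P /= h.
change (nbhs t [set s | s != t -> [set` `[a, +oo[] s -> P s]).
change (nbhs t [set s | [set` `[a, +oo[] s -> P s]) in h.
by apply: filterS h => x h _.
Qed.
End ScalarDerivative.

(** * Mean value inequalities and exponential decay *)

Section MeanValue.
Context {R : realType}.

(** Inside []u, v[] the one-sided derivative is two-sided, and at the ends it still gives continuity
    on the segment; the classical theorem therefore applies even for [u = a]. *)
Lemma MVT_from (g : R -> R) (a u v : R) : a <= u -> u <= v ->
  (forall r, a <= r -> derivable_from a g r) ->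
  exists2 c, u <= c <= v & g v - g u = derive_from a g c * (v - u).
Proof.
move=> au uv dg.
have [||c] := @MVT_segment _ g (derive_from a g) _ _ uv.
- move=> r; rewrite in_itv /= => /andP[ur rv].
  have ar : a < r by exact: le_lt_trans ur.
  by apply: (has_derive_from_interior ar); exact: (dg _ (ltW ar)).
- apply/subspace_continuousP => r /=; rewrite in_itv /= => /andP[ur rv].
  have ar : a <= r by exact: le_trans ur.
  have := has_derive_from_cvg (derivable_fromP (dg _ ar)).
  apply: cvg_trans; apply: cvg_app => P /= h.
  change (nbhs r [set q | [set` `[u, v]] q -> P q]).
  change (nbhs r [set q | [set` `[a, +oo[] q -> P q]) in h.
  apply: filterS h => q h /=; rewrite in_itv /= => /andP[uq qv]; apply: h.
  by rewrite /= in_itv /= andbT; exact: le_trans uq.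
- by rewrite in_itv /= => cuv E; exists c.
Qed.

Lemma mean_value_from (g : R -> R) (a t s L e : R) : a <= t -> a <= s ->
  (forall r, a <= r -> derivable_from a g r) ->
  (forall r, a <= r -> `|r - t| <= `|s - t| -> `|derive_from a g r - L| <= e) ->
  `|g s - g t - (s - t) * L| <= e * `|s - t|.
Proof.
move=> at_ as_ dg bdg.
have main u v : a <= u -> u <= v ->
    (forall r, u <= r <= v -> `|derive_from a g r - L| <= e) ->
    `|g v - g u - (v - u) * L| <= e * `|v - u|.
  move=> au uv H; have [c cuv ->] := MVT_from au uv dg.
  by rewrite [(v - u) * L]mulrC -mulrBl normrM ler_wpM2r// H.
have [ts|/ltW st] := leP t s.
  apply: main => // r /andP[tr rs]; apply: bdg; first exact: le_trans tr.
  by rewrite !ger0_norm ?subr_ge0//; lra.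
(* Up to sign the claim is symmetric in [s] and [t], so the remaining case is the first with
   endpoints exchanged. *)
have -> : g s - g t - (s - t) * L = - (g t - g s - (t - s) * L) by ring.
rewrite normrN [`|s - t|]distrC; apply: main => // r /andP[sr rt].
apply: bdg; first exact: le_trans sr.
by rewrite !ler0_norm ?subr_le0//; lra.
Qed.

(** The integrating factor [expR (c * s)] gives a product with nonpositive derivative, which the
    mean value theorem compares at [a] and [t]. *)
Lemma exp_decay_from (y dy : R -> R) (a c t : R) : a <= t ->
  (forall r, a <= r -> has_derive_from a y r (dy r)) ->
  (forall r, a <= r -> dy r <= - c * y r) ->
  y t <= expR (- c * (t - a)) * y a.
Proof.
move=> at_ hy dyc.
have hz r : a <= r -> has_derive_from a (fun s => expR (c * s) * y s) r
    (expR (c * r) * c * y r + expR (c * r) * dy r).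
  move=> ar; apply: has_derive_fromM; last exact: hy.
  apply: is_derive_has_derive_from.
  have := is_derive1_comp (is_derive_expR (c * r)) (is_deriveZ c (is_derive_id r 1)).
  by rewrite [c *: 1]mulr1.
have [|r /andP[ar rt]] := @MVT_from (fun s => expR (c * s) * y s) a a t (lexx a) at_.
  by move=> r ar; exact: has_derive_from_derivable (hz r ar).
rewrite (has_derive_from_unique ar (hz r ar)) => E.
have : expR (c * t) * y t - expR (c * a) * y a <= 0.
  rewrite E; apply: mulr_le0_ge0; last by rewrite subr_ge0.
  rewrite -mulrA -mulrDr; apply: mulr_ge0_le0; first exact: expR_ge0.
  by have := dyc r ar; lra.
rewrite subr_le0 -(ler_pM2l (expR_gt0 (- (c * t)))) !mulrA -!expRD.
by rewrite addNr expR0 mul1r => h; apply: le_trans h _; rewrite mulNr mulrBr opprB addrC.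
Qed.

Lemma mean_value (g dg : R -> R) (t s L e : R) :
  (forall r : R, is_derive r 1 g (dg r)) ->
  (forall r, `|r - t| <= `|s - t| -> `|dg r - L| <= e) ->
  `|g s - g t - (s - t) * L| <= e * `|s - t|.
Proof.
(* The base of the ray is chosen so that both points belong to it. *)
move=> dgE bdg; pose a := Num.min s t.
have hd r : has_derive_from a g r (dg r) by exact: is_derive_has_derive_from.
apply: (@mean_value_from g a) => [||r ar|r ar rt].
- by rewrite ge_min lexx orbT.
- by rewrite ge_min lexx.
- exact: has_derive_from_derivable (hd r).
- by rewrite (has_derive_from_unique ar (hd r)); exact: bdg.
Qed.
End MeanValue.

(** * Differentiability from continuous partial derivatives *)

Section VectorMeanValue.
Context {R : realType} {n : nat}.
Implicit Types (x y z L : 'rV[R]_n) (g : 'rV[R]_n -> R).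

Lemma ler_coord_norm x i : `|x 0 i| <= `|x|.
Proof.
rewrite [`|x|]mx_normrE.
exact: (le_bigmax _ (fun ij : 'I_1 * 'I_n => `|x ij.1 ij.2|) (0, i)).
Qed.

Lemma row_norm_le x (c : R) : 0 <= c -> (forall i, `|x 0 i| <= c) -> `|x| <= c.
Proof.
move=> c0 H; rewrite [`|x|]mx_normrE; apply: bigmax_le => // -[i j] _ /=.
by rewrite (ord1 i).
Qed.

Lemma is_derive_line g x (i : 'I_n) (r : R) :
  derivable g (x + r *: delta_mx 0 i) (delta_mx 0 i) ->
  is_derive r 1 (fun s => g (x + s *: delta_mx 0 i))
    (grad g (x + r *: delta_mx 0 i) 0 i).
Proof.
move=> dg.
have E : (fun h : R =>
    h^-1 *: (((fun s => g (x + s *: delta_mx 0 i)) \o shift r) (h *: 1)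
    - g (x + r *: delta_mx 0 i))) =
  (fun h : R => h^-1 *: ((g \o shift (x + r *: delta_mx 0 i)) (h *: delta_mx 0 i)
    - g (x + r *: delta_mx 0 i))).
  apply/funext => h /=; congr (_ *: (g _ - _)).
  by rewrite [h *: 1]mulr1 scalerDl addrCA.
by apply: DeriveDef; rewrite /derivable /derive E // mxE.
Qed.

(** The coordinates of [x] are replaced by those of [y] one at a time. Each of the [n] moves is a
    scalar mean value estimate costing at most [e * |y - x|]. *)
Lemma vector_mean_value g x y L (e : R) : 0 <= e ->
  (forall z, has_partials g z) ->
  (forall z, `|z - x| <= `|y - x| -> `|grad g z - L| <= e) ->
  `|g y - g x - dotv L (y - x)| <= n%:R * e * `|y - x|.
Proof.
move=> e0 dg bdg.
(* Intermediate points of the telescoping path: the first [k] coordinates come from [y], the others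
   from [x]. *)
pose h k : 'rV[R]_n := \row_i (if (i < k)%N then y 0 i else x 0 i).
have h0 : h 0%N = x by apply/rowP => i; rewrite mxE.
have hn : h n = y by apply/rowP => i; rewrite mxE ltn_ord.
suff main k : (k <= n)%N ->
    `|g (h k) - g x - \sum_(i < n | (i < k)%N) L 0 i * (y 0 i - x 0 i)|
      <= k%:R * e * `|y - x|.
  have := main n (leqnn n); rewrite hn; congr (`|_ - _| <= _).
  by apply: eq_big => [i|i _]; [rewrite ltn_ord|rewrite !mxE].
elim: k => [_|k IH kn].
  by rewrite h0 big_pred0 ?subrr ?subr0 ?normr0 ?mul0r.
pose i := Ordinal kn.
pose r := y 0 i - x 0 i.
have hk1 : h k.+1 = h k + r *: delta_mx 0 i.
  apply/rowP => j; rewrite !mxE eqxx /= ltnS leq_eqVlt.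
  have -> : (j == i) = (j == k :> nat) by [].
  case: ltngtP => [|_|jk] /=; rewrite ?mulr0 ?addr0//.
  by rewrite mulr1 /r (_ : j = i) ?[x 0 i + _]addrC ?subrK//; exact/val_inj.
have step : `|g (h k.+1) - g (h k) - r * L 0 i| <= e * `|r|.
  have := @mean_value _ (fun s => g (h k + s *: delta_mx 0 i))
    (fun s => grad g (h k + s *: delta_mx 0 i) 0 i) 0 r (L 0 i) e.
  rewrite scale0r addr0 -hk1 subr0; apply.
    by move=> s; apply: is_derive_line; exact: dg.
  move=> s; rewrite subr0 => sr.
  rewrite (_ : _ - _ = (grad g (h k + s *: delta_mx 0 i) - L) 0 i); last by rewrite !mxE.
  apply: le_trans (ler_coord_norm _ _) _; apply: bdg.
  (* In the sup norm no point of the path is farther from [x] than [y] is, so the hypothesis on the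
     gradient applies to it. *)
  apply: row_norm_le => // j; rewrite !mxE eqxx /=.
  have := ler_coord_norm (y - x) j; rewrite !mxE.
  have -> : (j == i) = (j == k :> nat) by [].
  case: ltngtP => [jk|jk|jk] /=; rewrite ?mulr0 ?addr0 ?subrr ?normr0//.
  rewrite mulr1 addrAC subrr add0r; apply: le_trans.
  by rewrite (_ : j = i) //; exact/val_inj.
have -> : \sum_(j < n | (j < k.+1)%N) L 0 j * (y 0 j - x 0 j) =
   r * L 0 i + \sum_(j < n | (j < k)%N) L 0 j * (y 0 j - x 0 j).
  rewrite (bigD1 i) //= mulrC; congr (_ + _); apply: eq_bigl => j.
  have -> : (j == i) = (j == k :> nat) by [].
  by rewrite ltnS ltn_neqAle andbC.
have rb : `|r| <= `|y - x| by have := ler_coord_norm (y - x) i; rewrite !mxE.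
rewrite (_ : g (h k.+1) - g x - _ = (g (h k.+1) - g (h k) - r * L 0 i) +
  (g (h k) - g x - \sum_(j < n | (j < k)%N) L 0 j * (y 0 j - x 0 j))); last by ring.
apply: le_trans (ler_normD _ _) _.
have -> : k.+1%:R * e * `|y - x| = e * `|y - x| + k%:R * e * `|y - x|.
  by rewrite -natr1; ring.
apply: lerD; last exact: IH (ltnW kn).
by apply: le_trans step _; exact: ler_wpM2l.
Qed.

Lemma dotv_norm_le L x : `|dotv L x| <= (\sum_i `|L 0 i|) * `|x|.
Proof.
rewrite /dotv; apply: le_trans (ler_norm_sum _ _ _) _.
rewrite mulr_suml; apply: ler_sum => i _; rewrite normrM.
by apply: ler_wpM2l => //; exact: ler_coord_norm.
Qed.

Lemma dotvB L x y : dotv L (x - y) = dotv L x - dotv L y.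
Proof. by rewrite /dotv -sumrB; apply: eq_bigr => i _; rewrite !mxE mulrBr. Qed.

Lemma dotvZ L (c : R) x : dotv L (c *: x) = c * dotv L x.
Proof. by rewrite /dotv mulr_sumr; apply: eq_bigr => i _; rewrite !mxE mulrCA. Qed.

Lemma dotvZl (c : R) L x : dotv (c *: L) x = c * dotv L x.
Proof. by rewrite /dotv mulr_sumr; apply: eq_bigr => i _; rewrite !mxE mulrA. Qed.
End VectorMeanValue.

(** * Total differentiability and the chain rule up to the boundary [t = 0] *)

Section ChainRule.
Context {R : realType} {n d : nat}.
Context (V : 'rV[R]_n -> R -> 'rV[R]_d -> R) (V_C1 : C1_xttau V).

Let D := [set z : 'rV[R]_n * R * 'rV[R]_d | 0 <= z.1.2].

Lemma within_dist_lt (U W : normedModType R) (A : set U) (F : U -> W) (z0 : U)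
    (e : R) : {within A, continuous F} -> A z0 -> 0 < e ->
  exists2 dl, 0 < dl & forall z, A z -> `|z - z0| < dl -> `|F z - F z0| < e.
Proof.
move=> /subspace_continuousP cF Az0 e0.
have := cF _ Az0; have FF : Filter (within A (nbhs z0)) by exact: within_filter.
move=> /cvgrPdist_lt/(_ e e0); rewrite /within /= => /nbhs_ballP[dl /= dl0 K].
exists dl => // z Az zz0; rewrite distrC; apply: K => //.
by rewrite -ball_normE /ball_ /= distrC.
Qed.

(** The increment is split into three moves, in [x], then in time, then in [tau]. Continuity of the
    partials keeps each close to its value at the base point, and all intermediate times stay
    nonnegative. *)
Lemma C1_differentiable x (t : R) tau (e : R) : 0 <= t -> 0 < e ->
  exists2 dl, 0 < dl & forall y s sigma, 0 <= s ->
    `|y - x| < dl -> `|s - t| < dl -> `|sigma - tau| < dl ->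
    `|V y s sigma - V x t tau - (dotv (partial_x V x t tau) (y - x)
       + (s - t) * partial_t V x t tau
       + dotv (partial_tau V x t tau) (sigma - tau))|
    <= e * (`|y - x| + `|s - t| + `|sigma - tau|).
Proof.
move=> t0 e0; case: V_C1 => dV cVx cVt cVtau.
(* The number of scalar variables; a tolerance [e / N] per partial absorbs the factors [n] and [d]
   of the vector estimates. *)
pose N : R := n%:R + d%:R + 1.
have n0 : 0 <= n%:R :> R by exact: ler0n.
have d0 : 0 <= d%:R :> R by exact: ler0n.
have N0 : 0 < N by rewrite /N; clear -n0 d0; lra.
have eN0 : 0 < e / N by exact: divr_gt0.
have Dz : D (x, t, tau) by [].
have [d1 d10 H1] := within_dist_lt cVx Dz eN0.
have [d2 d20 H2] := within_dist_lt cVt Dz eN0.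
have [d3 d30 H3] := within_dist_lt cVtau Dz eN0.
pose dl := Num.min d1 (Num.min d2 d3).
exists dl; first by rewrite !lt_min d10 d20.
move=> y s sigma s0 yx st sigtau.
have norm3 (y' : 'rV[R]_n) (s' : R) (sigma' : 'rV[R]_d) (r : R) :
    `|y' - x| < r -> `|s' - t| < r -> `|sigma' - tau| < r ->
    `|(y', s', sigma') - (x, t, tau)| < r.
  by move=> h1 h2 h3; rewrite !prod_normE /= !gt_max h1 h2 h3.
have le1 : dl <= d1 by rewrite ge_min lexx.
have le2 : dl <= d2 by rewrite !ge_min lexx orbT.
have le3 : dl <= d3 by rewrite !ge_min lexx !orbT.
have dl0 : 0 < dl by rewrite !lt_min d10 d20.
have S1 : `|V y s sigma - V x s sigma - dotv (partial_x V x t tau) (y - x)|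
    <= n%:R * (e / N) * `|y - x|.
  apply: (vector_mean_value (g := fun y => V y s sigma)).
  - exact: ltW.
  - by move=> z; have [] := dV z s sigma s0.
  - move=> z zx; apply: ltW.
    apply: (H1 (z, s, sigma)) => //; apply: lt_le_trans le1.
    by apply: norm3 => //; exact: le_lt_trans yx.
have S2 : `|V x s sigma - V x t sigma - (s - t) * partial_t V x t tau|
    <= e / N * `|s - t|.
  apply: (@mean_value_from _ (fun s => V x s sigma) 0) => //.
  - by move=> r r0; have [] := dV x r sigma r0.
  - move=> r r0 rt; apply: ltW.
    apply: (H2 (x, r, sigma)) => //; apply: lt_le_trans le2.
    by apply: norm3; rewrite ?subrr ?normr0 //; exact: le_lt_trans st.
have S3 : `|V x t sigma - V x t tau - dotv (partial_tau V x t tau) (sigma - tau)|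
    <= d%:R * (e / N) * `|sigma - tau|.
  apply: (vector_mean_value (g := fun sigma => V x t sigma)).
  - exact: ltW.
  - by move=> z; have [] := dV x t z t0.
  - move=> z zx; apply: ltW.
    apply: (H3 (x, t, z)) => //; apply: lt_le_trans le3.
    by apply: norm3; rewrite ?subrr ?normr0 //; exact: le_lt_trans sigtau.
set X := dotv _ (y - x) in S1 *; set Y := (s - t) * _ in S2 *.
set Z := dotv _ (sigma - tau) in S3 *.
have -> : V y s sigma - V x t tau - (X + Y + Z) =
  (V y s sigma - V x s sigma - X) + (V x s sigma - V x t sigma - Y) +
  (V x t sigma - V x t tau - Z) by ring.
apply: le_trans (ler_normD _ _) _; apply: le_trans (lerD (ler_normD _ _) (lexx _)) _.
have eE : e = N * (e / N) by rewrite mulrC divfK// gt_eqF.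
rewrite [in leRHS]eE !mulrDr; apply: lerD; first apply: lerD.
- apply: le_trans S1 _; apply: ler_wpM2r => //; apply: ler_wpM2r; first exact: ltW.
  by rewrite /N; clear -n0 d0; lra.
- apply: le_trans S2 _; apply: ler_wpM2r => //; rewrite ler_peMl//; first exact: ltW.
  by rewrite /N; clear -n0 d0; lra.
- apply: le_trans S3 _; apply: ler_wpM2r => //; apply: ler_wpM2r; first exact: ltW.
  by rewrite /N; clear -n0 d0; lra.
Qed.

(** [C1_xttau] speaks of the continuity of the partials only. Continuity of [V] itself is used
    later, since [V] appears in the time derivative of the weighted function. *)
Lemma C1_within_continuous : {within D, continuous (fun z => V z.1.1 z.1.2 z.2)}.
Proof.
apply/subspace_continuousP => -[[x t] tau] /= t0.
have FF : Filter (within D (nbhs (x, t, tau))) by exact: within_filter.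
have [dl dl0 H] := C1_differentiable x tau t0 ltr01.
set gx := partial_x _ _ _ _ in H; set gt := partial_t _ _ _ _ in H.
set gtau := partial_tau _ _ _ _ in H.
have sx : 0 <= \sum_i `|gx 0 i| by exact: sumr_ge0.
have st : 0 <= \sum_i `|gtau 0 i| by exact: sumr_ge0.
have gt0 : 0 <= `|gt| by [].
(* A local Lipschitz constant: the sizes of the three gradients, plus 1 each from linearization with
   error constant 1. *)
pose C : R := (\sum_i `|gx 0 i| + 1) + (`|gt| + 1) + (\sum_i `|gtau 0 i| + 1).
have C0 : 0 < C by rewrite /C; lra.
apply/cvgrPdist_le => e e0; rewrite /within /=; apply/nbhs_ballP.
exists (Num.min dl (e / C)) => /=; first by rewrite lt_min dl0 divr_gt0.
move=> [[y s] sigma]; rewrite -ball_normE /ball_ /= distrC.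
rewrite !prod_normE /= !gt_max => /andP[/andP[+ +] +].
rewrite /D /= !lt_min => /andP[y1 /ltW y2] /andP[t1 /ltW t2] /andP[g1 /ltW g2] s0.
have := H y s sigma s0 y1 t1 g1; rewrite mul1r.
set A := V _ _ _ - V _ _ _ => K; rewrite distrC -/A.
rewrite -[A](subrK (dotv gx (y - x) + (s - t) * gt + dotv gtau (sigma - tau))).
apply: le_trans (ler_normD _ _) _.
apply: (@le_trans _ _ ((`|y - x| + `|s - t| + `|sigma - tau|) +
  ((\sum_i `|gx 0 i|) * `|y - x| + `|gt| * `|s - t| +
   (\sum_i `|gtau 0 i|) * `|sigma - tau|))).
  apply: lerD => //; apply: le_trans (ler_normD _ _) _.
  apply: lerD (dotv_norm_le _ _); apply: le_trans (ler_normD _ _) _.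
  by apply: lerD (dotv_norm_le _ _) _; rewrite normrM mulrC.
have -> : e = C * (e / C) by rewrite mulrC divfK// gt_eqF.
set eta := e / C in y2 t2 g2 *.
have h1 : (\sum_i `|gx 0 i|) * `|y - x| <= (\sum_i `|gx 0 i|) * eta by exact: ler_wpM2l.
have h2 : `|gt| * `|s - t| <= `|gt| * eta by exact: ler_wpM2l.
have h3 : (\sum_i `|gtau 0 i|) * `|sigma - tau| <= (\sum_i `|gtau 0 i|) * eta
  by exact: ler_wpM2l.
by rewrite /C !mulrDl; clear -y2 t2 g2 h1 h2 h3; lra.
Qed.

Lemma C1_chain_rule (a t : R) (x : R -> 'rV[R]_n) (tau : R -> 'rV[R]_d) v w :
  0 <= a -> a <= t -> has_derive_from a x t v -> has_derive_from a tau t w ->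
  has_derive_from a (fun s => V (x s) s (tau s)) t
    (partial_t V (x t) t (tau t) + dotv (partial_x V (x t) t (tau t)) v
       + dotv (partial_tau V (x t) t (tau t)) w).
Proof.
move=> a0 at_ /has_derive_fromP hx /has_derive_fromP htau.
apply/has_derive_fromP => e e0.
set gx := partial_x _ _ _ _; set gt := partial_t _ _ _ _.
set gtau := partial_tau _ _ _ _.
have t0 : 0 <= t by exact: le_trans at_.
(* Near [t] the increments of [x], time and [tau] are at most [|v| + 1], 1 and [|w| + 1] times
   [|s - t|]; [K] is the sum of these factors. *)
pose K := `|v| + `|w| + 3.
have K0 : 0 < K by rewrite /K ltr_wpDl// addr_ge0.
(* [L] bounds the pairings with both gradients; the added 1 keeps it positive for division. *)
pose L := \sum_i `|gx 0 i| + \sum_i `|gtau 0 i| + 1.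
have L0 : 0 < L by rewrite /L ltr_wpDl// addr_ge0//; exact: sumr_ge0.
have e10 : 0 < e / 2 / K by rewrite !divr_gt0.
pose e2 := Num.min 1 (e / 2 / L).
have e20 : 0 < e2 by rewrite lt_min ltr01 !divr_gt0.
have [d1 d10 H1] := C1_differentiable (x t) (tau t) t0 e10.
have [d2 d20 H2] := hx e2 e20.
have [d3 d30 H3] := htau e2 e20.
exists (Num.min (d1 / K) (Num.min d2 d3)).
  by rewrite !lt_min divr_gt0//= d20.
move=> s as_; rewrite !lt_min => /and3P[sd1 sd2 sd3].
have {}H2 := H2 s as_ sd2; have {}H3 := H3 s as_ sd3.
set q := `|s - t| in H2 H3 sd1 *.
have q0 : 0 <= q by exact: normr_ge0.
have e21 : e2 <= 1 by rewrite ge_min lexx.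
have e2L : e2 <= e / 2 / L by rewrite ge_min lexx orbT.
have growth (U : normedModType R) (g : R -> U) u :
    `|g s - g t - (s - t) *: u| <= e2 * q -> `|g s - g t| <= (`|u| + 1) * q.
  move=> h; rewrite -[g s - g t](subrK ((s - t) *: u)).
  apply: le_trans (ler_normD _ _) _; rewrite normrZ -/q addrC mulrDl [q * _]mulrC.
  by rewrite lerD2l; apply: le_trans h _; exact: ler_wpM2r.
have gx1 := growth _ _ _ H2; have gtau1 := growth _ _ _ H3.
move: sd1; rewrite ltr_pdivlMr// => sd1.
have v0 : 0 <= `|v| by []. have w0 : 0 <= `|w| by [].
have small u : 0 <= u -> u <= K -> u * q < d1.
  by move=> u0 uK; apply: le_lt_trans sd1; rewrite mulrC; exact: ler_wpM2l.
have b1 : `|x s - x t| < d1.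
  by apply: le_lt_trans gx1 _; apply: small; rewrite /K; clear -v0 w0; lra.
have b2 : `|s - t| < d1.
  by rewrite -/q -[q]mul1r; apply: small; rewrite /K; clear -v0 w0; lra.
have b3 : `|tau s - tau t| < d1.
  by apply: le_lt_trans gtau1 _; apply: small; rewrite /K; clear -v0 w0; lra.
have := H1 (x s) s (tau s) (le_trans a0 as_) b1 b2 b3.
rewrite -/gx -/gt -/gtau -/q => h.
set A := V _ _ _ - V _ _ _ in h *.
(* The first group is the linearization error of [V], the second the errors of the two curves paired
   with the gradients; each receives [e / 2]. *)
have E : A - (s - t) *: (gt + dotv gx v + dotv gtau w) =
  (A - (dotv gx (x s - x t) + (s - t) * gt + dotv gtau (tau s - tau t)))
  + (dotv gx (x s - x t - (s - t) *: v) + dotv gtau (tau s - tau t - (s - t) *: w)).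
  rewrite [dotv gx (_ - _ *: _)]dotvB [dotv gtau (_ - _ *: _)]dotvB !dotvZ.
  by rewrite /GRing.scale /=; ring.
rewrite E; apply: le_trans (ler_normD _ _) _.
rewrite [e in leRHS](splitr e) [leRHS]mulrDl; apply: lerD.
  apply: le_trans h _.
  apply: (@le_trans _ _ (e / 2 / K * (K * q))).
    rewrite ler_pM2l//; apply: (@le_trans _ _ ((`|v| + 1) * q + q + (`|w| + 1) * q)).
      by apply: lerD => //; rewrite lerD2r.
    by rewrite -[q in X in _ + X + _]mul1r -!mulrDl ler_wpM2r// /K; clear -v0 w0; lra.
  by rewrite mulrA divfK// gt_eqF.
apply: (@le_trans _ _ (L * (e / 2 / L * q))); last first.
  by rewrite mulrA mulrCA mulfV ?mulr1// gt_eqF.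
apply: le_trans (ler_normD _ _) _.
have bq : e2 * q <= e / 2 / L * q by exact: ler_wpM2r.
have B0 : 0 <= e / 2 / L * q by rewrite mulr_ge0// ltW// !divr_gt0.
apply: le_trans (lerD (dotv_norm_le _ _) (dotv_norm_le _ _)) _.
have sx : 0 <= \sum_i `|gx 0 i| by exact: sumr_ge0.
have stau : 0 <= \sum_i `|gtau 0 i| by exact: sumr_ge0.
rewrite /L !mulrDl mul1r -[leLHS]addr0; apply: lerD => //; apply: lerD.
  by apply: ler_wpM2l => //; apply: le_trans H2 _.
by apply: ler_wpM2l => //; apply: le_trans H3 _.
Qed.
End ChainRule.

(** * Comparison functions *)

Section Comparison.
Context {R : realType}.
Implicit Types rho sg : R -> R.

Lemma continuous_comp_within (S T U : topologicalType) (A : set S) (B : set T)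
    (f : S -> T) (g : T -> U) :
  {within A, continuous f} -> (forall x, A x -> B (f x)) ->
  {within B, continuous g} -> {within A, continuous (g \o f)}.
Proof.
move=> /subspace_continuousP cf fAB /subspace_continuousP cg.
apply/subspace_continuousP => x Ax P Pg.
have h : within B (nbhs (f x)) (g @^-1` P) := cg _ (fAB _ Ax) P Pg.
have k : nbhs x [set y | A y -> B (f y) -> P (g (f y))] := cf _ Ax _ h.
change (nbhs x [set y | A y -> P (g (f y))]).
by apply: filterS k => y k Ay; exact: (k Ay (fAB _ Ay)).
Qed.

(** [rho] is constrained only on the half-line; truncating its argument gives continuity on the
    whole line, which composes without domain conditions. *)
Lemma Kinfty_continuous_max rho :
  Kinfty rho -> continuous (fun s : R => rho (Num.max s 0)).
Proof.
case=> crho _ _ _; apply/(@continuous_subspace_setT R R).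
refine (@continuous_comp_within R R R setT [set` `[0, +oo[]
  (fun s : R => Num.max s 0) rho _ _ crho).
  apply: continuous_subspaceT => s.
  by apply: continuous_max; [exact: cvg_id|exact: cvg_cst].
by move=> s _ /=; rewrite in_itv /= andbT le_max lexx orbT.
Qed.

Lemma Kinfty_ge0 rho s : Kinfty rho -> 0 <= s -> 0 <= rho s.
Proof.
case=> _ incr _ r0; rewrite le_eqVlt => /predU1P[<-|s0]; first by rewrite r0.
by rewrite -r0 ltW// incr.
Qed.

Lemma Kinfty_scale (k : R) rho : 0 < k -> Kinfty rho -> Kinfty (fun s => k * rho s).
Proof.
move=> k0 [crho incr unbd r0]; split.
- move/subspace_continuousP: crho => crho; apply/subspace_continuousP => s s0.
  by apply: cvgM; [exact: cvg_cst|exact: crho].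
- by move=> s r s0 sr; rewrite ltr_pM2l//; exact: incr.
- move=> M; have [s s0 h] := unbd (M / k); exists s => //.
  by rewrite mulrC -ler_pdivrMr.
- by rewrite r0 mulr0.
Qed.

Lemma Kinfty_posdef rho : Kinfty rho -> posdef rho.
Proof.
move=> Krho; have [crho incr _ r0] := Krho; split => // s s0.
  exact: Kinfty_ge0.
split=> [rs0|->//]; apply/eqP; rewrite eq_le s0 andbT leNgt.
by apply/negP => /(incr 0 _ (lexx 0)); rewrite r0 rs0 ltxx.
Qed.

Lemma Kinfty_inverse rho : Kinfty rho -> exists sg,
  [/\ continuous sg, {homo sg : x y / x < y}, sg 0 = 0,
      forall s, 0 <= s -> sg (rho s) = s &
      forall y, 0 <= y -> rho (sg y) = y].
Proof.
move=> Krho; have [_ incr unbd r0] := Krho.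
(* An increasing bijection of R extending rho, so that its inverse is
   continuous on the whole line. *)
pose ext s := rho (Num.max s 0) + Num.min s 0.
have ext_ge0 s : 0 <= s -> ext s = rho s.
  by move=> s0; rewrite /ext max_l// min_r// addr0.
have cext : continuous ext.
  move=> s; apply: cvgD; first exact: Kinfty_continuous_max.
  by apply: continuous_min; [exact: cvg_id|exact: cvg_cst].
have ext_incr : {homo ext : x y / x < y}.
  move=> x y xy; rewrite /ext; have [x0|x0] := leP 0 x.
    have y0 : 0 < y by exact: le_lt_trans xy.
    by rewrite !max_l ?(ltW y0)// !min_r ?(ltW y0)// !addr0 incr.
  rewrite r0 add0r.
  have [y0|y0] := leP 0 y.
    rewrite addr0; apply: lt_le_trans x0 _; exact: Kinfty_ge0.
  by rewrite r0 add0r.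
have ext_inj : injective ext.
  move=> x y /eqP; case: (ltgtP x y) => // /ext_incr h.
    by rewrite lt_eqF.
  by rewrite gt_eqF.
have ext_surj y : exists s, ext s = y.
  have [s s0 ys] := unbd y.
  (* Left of 0 the extension is the identity, so [a] has a value at most [y]; unboundedness of [rho]
     supplies the other end for the intermediate value theorem. *)
  pose a := Num.min y 0.
  have as_ : a <= s by apply: le_trans s0; rewrite ge_min lexx orbT.
  have exta : ext a = a.
    by rewrite /ext max_r ?r0 ?add0r ?min_l// ge_min lexx orbT.
  have := @IVT _ ext a s y as_ (continuous_subspaceT cext).
  case; last by move=> c _ <-; exists c.
  have ay : a <= y by rewrite /a ge_min lexx.
  by rewrite exta (ext_ge0 _ s0) ge_min ay /= le_max ys orbT.
have [sg sgE] := choice ext_surj.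
have sgK : cancel ext sg by move=> s; apply: ext_inj.
exists sg; split.
- move=> y; rewrite -(sgE y).
  have sgK_near : {near sg y, cancel ext sg}.
    by rewrite /prop_near1; near=> z; exact: sgK.
  have cext_near : \forall z \near sg y, {for z, continuous ext}.
    by near=> z; exact: cext.
  exact: (nbhs_singleton (near_can_continuous sgK_near cext_near)).
- move=> x y xy; rewrite ltNge; apply/negP => h.
  have : ext (sg y) <= ext (sg x).
    by move: h; rewrite le_eqVlt => /predU1P[->//|/ext_incr/ltW].
  by rewrite !sgE leNgt xy.
- by apply: ext_inj; rewrite sgE ext_ge0.
- by move=> s s0; rewrite -ext_ge0.
- move=> y y0; have h : 0 <= sg y.
    rewrite leNgt; apply/negP => /ext_incr.
    by rewrite sgE ext_ge0// r0 ltNge y0.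
  by rewrite -ext_ge0// sgE.
Unshelve. all: by end_near.
Qed.

Lemma KL_exp_decay rho1 rho2 (C c : R) :
  Kinfty rho1 -> Kinfty rho2 -> 0 < C -> 0 < c ->
  exists2 beta : R -> R -> R, KL beta &
    forall s r t : R, 0 <= s -> 0 <= r ->
      rho1 s <= C * expR (- c * t) * rho2 r -> s <= beta r t.
Proof.
move=> K1 K2 C0 c0; have [sg [csg sgincr sg0 sgK rho1sg]] := Kinfty_inverse K1.
have [_ incr2 unbd2 rho20] := K2.
have sg_le : {homo sg : x y / x <= y} by exact: ltW_homo.
have Ce t : 0 < C * expR (- c * t) by rewrite mulr_gt0// expR_gt0.
(* Truncation at 0 and an inverse [sg] continuous on the whole line make [beta] jointly continuous
   on the plane. *)
pose beta (r t : R) := sg (C * expR (- c * t) * rho2 (Num.max r 0)).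
have cbeta : continuous (fun z : R * R => beta z.1 z.2).
  move=> z; apply: (@continuous_comp _ _ _
    (fun z : R * R => C * expR (- c * z.2) * rho2 (Num.max z.1 0)) sg); last exact: csg.
  apply: cvgM; [apply: cvgM; first exact: cvg_cst|].
    apply: (@continuous_comp _ _ _ (fun z : R * R => - c * z.2) expR).
      by apply: cvgM; [exact: cvg_cst|exact: cvg_snd].
    exact: (@continuous_expR R).
  apply: (@continuous_comp _ _ _ (fun z : R * R => z.1)
    (fun s : R => rho2 (Num.max s 0))).
    exact: cvg_fst.
  exact: Kinfty_continuous_max.
exists beta; last first.
  move=> s r t s0 r0 h; rewrite -[s]sgK//; rewrite /beta (max_l r0); exact: sg_le.
split.
- exact: continuous_subspaceT.
- move=> t t0; split.
  + apply: continuous_subspaceT => s.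
    apply: (@continuous_comp _ _ _
      (fun s : R => C * expR (- c * t) * rho2 (Num.max s 0)) sg); last exact: csg.
    by apply: cvgM; [exact: cvg_cst|exact: (Kinfty_continuous_max K2)].
  + move=> s r s0 sr; apply: sgincr.
    have r0 : 0 <= r by apply: le_trans s0 (ltW sr).
    by rewrite !max_l// ltr_pM2l//; exact: incr2.
  (* Applying [rho1] to the target reduces unboundedness of [beta] in its first argument to that of
     [rho2]. *)
  + move=> M; pose N := rho1 (Num.max M 0).
    have [s s0 h] := unbd2 (N / (C * expR (- c * t))).
    exists s => //; rewrite /beta (max_l s0).
    have M0 : 0 <= Num.max M 0 by rewrite le_max lexx orbT.
    apply: (@le_trans _ _ (Num.max M 0)); first by rewrite le_max lexx.
    rewrite -[leLHS](sgK _ M0); apply: sg_le.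
    by move: h; rewrite ler_pdivrMr// mulrC.
  + by rewrite /beta maxxx rho20 mulr0.
- move=> s t u s0 t0 tu; apply: sg_le; rewrite (max_l s0).
  apply: ler_wpM2r; first exact: Kinfty_ge0.
  by rewrite ler_pM2l// ler_expR !mulNr lerN2 ler_pM2l.
- move=> s s0; set M := rho2 (Num.max s 0).
  have lim_exp : expR (- (c * t)) @[t --> +oo] --> (0 : R).
    apply: (@cvg_comp _ _ _ (fun t => c * t) (fun t => expR (- t)) _ +oo); last first.
      exact: (@cvgr_expR R).
    by apply: gt0_cvgMry => //; exact: cvg_id.
  have lim0 : C * expR (- c * t) * M @[t --> +oo] --> (0 : R).
    rewrite (_ : 0 = C * 0 * M); last by rewrite mulr0 mul0r.
    apply: cvgM; last exact: cvg_cst.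
    apply: cvgM; first exact: cvg_cst.
    by under eq_fun do rewrite mulNr.
  have := cvg_comp _ _ lim0 (csg 0).
  by rewrite sg0.
Qed.
End Comparison.

(** * Window averages *)

Section Averaging.
Context {R : realType}.
Implicit Types g : R -> R.
Local Notation mu := (@lebesgue_measure R).

Lemma within_ray_integrable g (a s u : R) : {within `[a, +oo[, continuous g} ->
  a <= s -> mu.-integrable `[s, u] (EFin \o g).
Proof.
move=> cg as_; apply: continuous_compact_integrable; first exact: segment_compact.
apply: continuous_subspaceW cg => x /=; rewrite !in_itv /= andbT => /andP[sx _].
exact: le_trans sx.
Qed.

Lemma ray_primitive g (a : R) : {within `[a, +oo[, continuous g} ->
  exists2 G : R -> R, forall u : R, a < u -> is_derive u 1 G (g u) &
    forall s u : R, a < s -> s <= u -> \int[mu]_(x in `[s, u]) g x = G u - G s.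
Proof.
move=> cg; have int_g s u : a <= s -> mu.-integrable `[s, u] (EFin \o g).
  exact: within_ray_integrable.
have [cg_int _] := (continuous_within_itvcyP a g).1 cg.
exists (fun u => \int[mu]_(x in `[a, u]) g x) => [u au|s u as_ su].
  (* The fundamental theorem needs a segment having [u] in its interior; [u + 1] is an arbitrary
     right end. *)
  have u1 : u < u + 1 by lra.
  have [|dG GE] := @continuous_FTC1_closed _ g a u (u + 1) u1 (int_g _ _ (lexx a)) au.
    by apply: cg_int; rewrite in_itv /= andbT.
  by rewrite -GE derive1E; exact: DeriveDef.
rewrite Rintegral_itvB ?bnd_simp ?int_g ?(ltW as_)//.
rewrite Rintegral_itv_obnd_cbnd//; apply: integrableS (int_g s u (ltW as_)) => //.
exact: subset_itv_oc_cc.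
Qed.

Lemma is_derive_shift (G : R -> R) (T u l : R) :
  is_derive (u - T) 1 G l -> is_derive u 1 (fun v => G (v - T)) l.
Proof.
move=> /is_deriveP H; apply/is_deriveP => e /H[dl dl0 K]; exists dl => // s su.
have E : s - T - (u - T) = s - u by ring.
by have := K (s - T); rewrite E; apply.
Qed.

(** With [G] a primitive of [g] and [H] one of [G], the double integral becomes
    [T * G u - (H u - H (u - T))], which is differentiated term by term. *)
Lemma averaging_weight g (T M : R) : continuous g -> 0 < T ->
  (forall l, `|g l| <= M) ->
  let F (u : R) := \int[mu]_(s in `[u - T, u]) \int[mu]_(l in `[s, u]) g l in
  exists dF : R -> R,
  [/\ forall u : R, 0 <= u -> is_derive u 1 F (dF u),
      forall u, 0 <= u -> `|F u| <= T * T * M,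
      {within `[0, +oo[, continuous dF} &
      forall u, 0 <= u -> dF u = T * g u - \int[mu]_(l in `[u - T, u]) g l].
Proof.
move=> cg T0 gM F.
(* The base points lie to the left of all windows [u - T, u] with u > -1. *)
have [G dG intG] := @ray_primitive g (- T - 2) (continuous_subspaceT cg).
have cG (a : R) : - T - 2 < a -> {within `[a, +oo[, continuous G}.
  move=> a0; apply: derivable_within_continuous => x; rewrite in_itv /= andbT => ax.
  by have [] := dG x (lt_le_trans a0 ax).
(* [G] is known to be differentiable only strictly right of [- T - 2], so the second primitive
   starts further right. *)
have T1 : - T - 2 < - T - 1 by lra.
have [H dH intH] := @ray_primitive G (- T - 1) (cG _ T1).
have FE u : - 1 < u -> F u = T * G u - (H u - H (u - T)).
  move=> u1; rewrite /F.
  have uT : u - T <= u by lra.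
  have uTl : - T - 1 < u - T by lra.
  rewrite -intH//.
  transitivity (\int[mu]_(s in `[u - T, u]) (G u - G s)).
    apply: eq_Rintegral => s; rewrite inE /= in_itv /= => /andP[us su].
    by apply: intG => //; lra.
  have mI : measurable (`[u - T, u] : set R) by [].
  have muI : lebesgue_measure (`[u - T, u] : set R) = T%:E.
    rewrite lebesgue_measure_itv /= lte_fin; have -> : u - T < u by lra.
    by rewrite -EFinB; congr (_%:E); ring.
  have icst : mu.-integrable `[u - T, u] (EFin \o (fun=> G u)).
    apply: (@within_ray_integrable _ (u - T)) => //.
    by apply: continuous_subspaceT => z; exact: cvg_cst.
  have iG : mu.-integrable `[u - T, u] (EFin \o G).
    by apply: (@within_ray_integrable _ (u - T)) => //; apply: cG; lra.
  rewrite RintegralB// Rintegral_cst//; congr (_ - _).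
  by rewrite mulrC; congr (_ * _); rewrite -[RHS]/(fine T%:E); congr fine; exact: muI.
pose dF u := T * g u - (G u - G (u - T)).
have dT (K k : R -> R) (a : R) : (forall u : R, a < u -> is_derive u 1 K (k u)) ->
    forall u, a + T < u -> is_derive u 1 (fun v => K v - K (v - T)) (k u - k (u - T)).
  move=> dK u au; apply: is_deriveB; first by apply: dK; lra.
  by apply: is_derive_shift; apply: dK; lra.
exists dF; split.
- move=> u u0.
  have /is_deriveP D :
      is_derive u 1 (fun v => T * G v - (H v - H (v - T))) (dF u).
    apply: is_deriveB; last by apply: (dT _ _ _ dH); lra.
    by apply: is_deriveZ; apply: dG; lra.
  (* The closed form [FE] holds for arguments above -1; radius at most 1 stays there, which makes
     the derivative two-sided even at [u = 0]. *)
  apply/is_deriveP => e /D[dl dl0 K]; exists (Num.min dl 1).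
    by rewrite lt_min dl0 ltr01.
  move=> s; rewrite lt_min => /andP[sd]; rewrite ltr_norml => /andP[s1 s2].
  by rewrite !FE; [exact: K|lra|lra].
- move=> u u0; rewrite FE; last lra.
  have uT : u - T <= u by lra.
  (* Two mean value theorems: [F u] equals [T * (G u - G xi)], and [G u - G xi] is a value of [g]
     times [u - xi], which is at most [T]. *)
  have [||xi] := @MVT_segment _ H G _ _ uT.
  + by move=> x; rewrite in_itv /= => /andP[ux _]; apply: dH; lra.
  + apply: derivable_within_continuous => x; rewrite in_itv /= => /andP[ux _].
    have ax : - T - 1 < x by lra.
    by have [] := dH x ax.
  rewrite in_itv /= => /andP[xi1 xi2] ->.
  have [||eta] := @MVT_segment _ G g _ _ xi2.
  + by move=> x; rewrite in_itv /= => /andP[ux _]; apply: dG; lra.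
  + apply: derivable_within_continuous => x; rewrite in_itv /= => /andP[ux _].
    have ax : - T - 2 < x by lra.
    by have [] := dG x ax.
  move=> _ Geta.
  have -> : T * G u - G xi * (u - (u - T)) = T * (G u - G xi) by ring.
  rewrite Geta !normrM (gtr0_norm T0) -mulrA ler_pM2l// mulrC.
  by apply: ler_pM => //; rewrite ger0_norm; lra.
- apply: continuous_in_subspaceT => u; rewrite inE /= in_itv /= andbT => u0.
  apply: cvgB; first by apply: cvgM; [exact: cvg_cst|exact: cg].
  have uT : - T - 2 + T < u by lra.
  have [dGT _] := dT _ _ _ dG u uT.
  by move/derivable1_diffP: dGT => /differentiable_continuous.
- by move=> u u0; rewrite /dF intG//; lra.
Qed.
End Averaging.

(** * Coordinatewise limits, the Euclidean norm and the Cauchy-Schwarz inequality *)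

Section RowVectors.
Context {R : realType} {n : nat}.
Implicit Types (u v : 'rV[R]_n).

Lemma cvg_row (T : Type) (F : set_system T) (FF : Filter F) (f : T -> 'rV[R]_n) v :
  (forall i, f x 0 i @[x --> F] --> v 0 i) -> f x @[x --> F] --> v.
Proof.
move=> H; apply/cvgrPdist_le => e e0.
have : \forall x \near F, forall i, `|v 0 i - f x 0 i| <= e.
  by apply: filter_forall => i; move/cvgrPdist_le: (H i); apply.
apply: filterS => x Hx; apply: row_norm_le; first exact: ltW.
by move=> i; rewrite !mxE; exact: Hx.
Qed.

Lemma cvg_dotv (T : Type) (F : set_system T) (FF : Filter F)
    (f g : T -> 'rV[R]_n) u v :
  f x @[x --> F] --> u -> g x @[x --> F] --> v ->
  dotv (f x) (g x) @[x --> F] --> dotv u v.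
Proof.
move=> fu gv; apply: cvg_big => [|i _]; first exact: add_continuous.
have coord (h : T -> 'rV[R]_n) (w : 'rV[R]_n) :
    h x @[x --> F] --> w -> h x 0 i @[x --> F] --> w 0 i.
  by move=> hw; exact: (cvg_comp _ _ hw (@coord_continuous R 1 n 0 i w)).
by apply: cvgM; exact: coord.
Qed.

Lemma has_derive_from_row (a t : R) (x : R -> 'rV[R]_n) v :
  (forall i, has_derive_from a (fun s => x s 0 i) t (v 0 i)) ->
  has_derive_from a x t v.
Proof.
have F : Filter (within `[a, +oo[ t^').
  by apply: within_filter; exact: dnbhs_filter.
move=> H; apply: cvg_row => i; have := H i.
rewrite /has_derive_from /quotient_from.
suff -> : (fun s => (s - t)^-1 *: (x s 0 i - x t 0 i)) =
  (fun s => ((s - t)^-1 *: (x s - x t)) 0 i) by [].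
by apply/funext => s; rewrite !mxE.
Qed.

Lemma enorm_ge0 u : 0 <= enorm u. Proof. exact: sqrtr_ge0. Qed.

Lemma ler_coord_enorm u i : `|u 0 i| <= enorm u.
Proof.
rewrite -sqrtr_sqr ler_wsqrtr// (bigD1 i)//= lerDl.
by apply: sumr_ge0 => j _; exact: sqr_ge0.
Qed.

Lemma enorm_le u v : (forall i, `|u 0 i| <= v 0 i) -> enorm u <= enorm v.
Proof.
move=> uv; apply: ler_wsqrtr; apply: ler_sum => i _.
rewrite -[leLHS]real_normK ?num_real//; apply: lerXn2r; rewrite ?nnegrE//.
by apply: le_trans (uv i).
Qed.

Lemma dotv_le_enorm u v : dotv u v <= enorm u * enorm v.
Proof.
have sq_ge0 (w : 'rV[R]_n) : 0 <= \sum_i w 0 i ^+ 2.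
  by apply: sumr_ge0 => i _; exact: sqr_ge0.
rewrite -sqrtrM//; apply: le_trans (ler_norm _) _; rewrite -sqrtr_sqr.
apply: ler_wsqrtr; rewrite -subr_ge0.
(* Lagrange's identity *)
have : 0 <= \sum_i \sum_j (u 0 i * v 0 j - u 0 j * v 0 i) ^+ 2.
  by apply: sumr_ge0 => i _; apply: sumr_ge0 => j _; exact: sqr_ge0.
have -> : \sum_i \sum_j (u 0 i * v 0 j - u 0 j * v 0 i) ^+ 2 =
    2 * ((\sum_i u 0 i ^+ 2) * (\sum_i v 0 i ^+ 2) - dotv u v ^+ 2).
  have S (f g : 'I_n -> R) : \sum_i \sum_j f i * g j = (\sum_i f i) * (\sum_i g i).
    by rewrite mulr_suml; apply: eq_bigr => i _; rewrite mulr_sumr.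
  transitivity (\sum_i \sum_j (u 0 i ^+ 2 * v 0 j ^+ 2 + v 0 i ^+ 2 * u 0 j ^+ 2
     - 2 * (u 0 i * v 0 i) * (u 0 j * v 0 j))).
    by apply: eq_bigr => i _; apply: eq_bigr => j _; ring.
  under eq_bigr do rewrite sumrB big_split /=.
  rewrite sumrB big_split /= !S /dotv -mulr_sumr; ring.
by rewrite pmulr_rge0.
Qed.
End RowVectors.

(** * Continuity, rescaling and bounds for the curve [p] *)

Section BoundedCurve.
Context {R : realType} {d : nat} (p : R -> 'rV[R]_d).
Context (p_derivable : forall (i : 'I_d) (r : R), derivable (fun s => p s 0 i) r 1).

Lemma curve_continuous : continuous p.
Proof.
move=> r; apply: cvg_row => i.
have dp : derivable (fun s => p s 0 i) r 1 by exact: p_derivable.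
by move/derivable1_diffP: dp => /differentiable_continuous.
Qed.

Lemma curve_rescaled_derive (alpha t : R) :
  has_derive_from 0 (fun s => p (s / alpha)) t (alpha^-1 *: curve_deriv p (t / alpha)).
Proof.
apply: has_derive_from_row => i; apply: is_derive_has_derive_from.
have dpi : is_derive (t / alpha) 1 (fun s => p s 0 i) (curve_deriv p (t / alpha) 0 i).
  by rewrite mxE derive1E; apply: DeriveDef; first exact: p_derivable.
have dscale : is_derive t 1 (fun s : R => s / alpha) alpha^-1.
  have := is_deriveZ alpha^-1 (is_derive_id t (1 : R)).
  rewrite [_ *: 1]mulr1 (_ : alpha^-1 \*: id = fun s => s / alpha)//.
  by apply/funext => s; rewrite /= /GRing.scale /= mulrC.
rewrite (_ : _ 0 i = curve_deriv p (t / alpha) 0 i / alpha);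
  last by rewrite [LHS]mxE mulrC.
exact: (@is_derive1_comp R (fun s => p s 0 i) (fun s => s / alpha) t _ _
  dpi dscale).
Qed.

(** The range of [p] need not be closed, but it lies in a compact cube, on which [q] is bounded. *)
Lemma continuous_bounded_along (q : 'rV[R]_d -> R) : continuous q ->
  (exists M : R, forall r, enorm (p r) <= M) ->
  exists M : R, forall r, `|q (p r)| <= M.
Proof.
move=> cq [B pB].
have cpt : compact [set v : 'rV[R]_d | forall i, [set` `[- B, B]] (v ord0 i)].
  by apply: (@rV_compact R d (fun=> [set` `[- B, B]])) => i; exact: segment_compact.
have := compact_bounded (continuous_compact (continuous_subspaceT cq) cpt).
(* Boundedness provides a bound by every number strictly above [M], hence [M + 1]. *)
case=> M [_ H]; exists (M + 1) => r; apply: (H (M + 1)); first by rewrite ltrDl.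
exists (p r) => //= i; rewrite in_itv /= -ler_norml.
exact: le_trans (ler_coord_enorm _ _) (pB r).
Qed.

(** A [sup] is an upper bound only for a set bounded above; the norm of the vector of componentwise
    bounds shows that this set is. *)
Lemma curve_deriv_le_sup r :
  (forall i : 'I_d, exists M : R, forall r, `|curve_deriv p r 0 i| <= M) ->
  enorm (curve_deriv p r) <= sup (range (fun r => enorm (curve_deriv p r))).
Proof.
move=> /choice[M MP]; apply: ub_le_sup; last by exists r.
exists (enorm (\row_i M i)) => _ [s _ <-]; apply: enorm_le => i.
by rewrite [leRHS]mxE; exact: MP.
Qed.
End BoundedCurve.

(** * The exponent of the weight in the time scale [t / alpha] *)

Section Weight.
Context {R : realType}.
Local Notation mu := (@lebesgue_measure R).

(** The exponent of [Vsharp], with [g] standing for the composite of [q] and [p]. *)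
Definition window_exponent (g : R -> R) (T alpha t : R) : R := alpha / T *
  \int[mu]_(s in `[t / alpha - T, t / alpha]) \int[mu]_(l in `[s, t / alpha]) g l.

Lemma window_exponent_derive (g : R -> R) (T alpha cb M : R) :
  continuous g -> (forall l, `|g l| <= M) -> 0 < T -> 0 < alpha ->
  (forall u, 0 <= u -> cb <= \int[mu]_(l in `[u - T, u]) g l) ->
  exists (dE : R -> R) (K : R),
  [/\ forall t : R, 0 <= t -> is_derive t 1 (window_exponent g T alpha) (dE t),
      forall t, 0 <= t -> `|window_exponent g T alpha t| <= K,
      {within `[0, +oo[, continuous dE} &
      forall t, 0 <= t -> dE t <= g (t / alpha) - cb / T].
Proof.
move=> cg gM T0 alpha0 mean_g.
have [dF [derF boundF contF dFE]] := averaging_weight cg T0 gM.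
have resc t : 0 <= t -> 0 <= t / alpha by move=> t0; rewrite divr_ge0// ltW.
(* The factor [1 / alpha] from rescaling time cancels the [alpha] of [alpha / T]; the second witness
   scales the bound [T * T * M] on the double integral. *)
exists (fun t => dF (t / alpha) / T), (alpha / T * (T * T * M)); split.
- move=> t t0; apply/is_deriveP => e e0.
  have /is_deriveP/(_ (e * T)) := derF _ (resc _ t0).
  rewrite mulr_gt0// => /(_ isT)[dl dl0 H].
  exists (dl * alpha) => [|s st]; first exact: mulr_gt0.
  have E1 : s / alpha - t / alpha = (s - t) / alpha by rewrite mulrBl.
  have := H (s / alpha); rewrite E1 normrM normfV (gtr0_norm alpha0) ltr_pdivrMr//.
  move=> /(_ st) h; rewrite /window_exponent.
  set F1 := Rintegral _ _ _ in h *; set F2 := Rintegral _ _ _ in h *.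
  have -> : alpha / T * F1 - alpha / T * F2 - (s - t) *: (dF (t / alpha) / T) =
      alpha / T * (F1 - F2 - ((s - t) / alpha) *: dF (t / alpha)).
    by rewrite /GRing.scale /=; field; rewrite !gt_eqF.
  have aT0 : 0 < alpha / T by rewrite divr_gt0.
  rewrite normrM (gtr0_norm aT0).
  apply: le_trans (ler_wpM2l (ltW aT0) h) _.
  by rewrite le_eqVlt; apply/orP; left; apply/eqP; field; rewrite !gt_eqF.
- move=> t t0; rewrite /window_exponent normrM (gtr0_norm (divr_gt0 alpha0 T0)).
  by apply: ler_wpM2l; [rewrite ltW// divr_gt0|exact: (boundF _ (resc _ t0))].
- have cd : {within `[0, +oo[, continuous (dF \o (fun t => t / alpha))}.
    refine (@continuous_comp_within R R R _ _ (fun t => t / alpha) dF _ _ contF).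
      by apply: continuous_subspaceT => t; apply: cvgM; [exact: cvg_id|exact: cvg_cst].
    by move=> t; rewrite /= !in_itv /= !andbT; exact: resc.
  move/subspace_continuousP: cd => cd; apply/subspace_continuousP => t t0.
  by apply: cvgM; [exact: cd|exact: cvg_cst].
- move=> t t0; rewrite dFE ?resc// mulrBl.
  rewrite [T * _]mulrC mulfK ?gt_eqF// lerD2l lerN2 ler_pM2r ?invr_gt0//.
  exact/mean_g/resc.
Qed.
End Weight.

(** * The exponentially weighted function *)

Section WeightedFunction.
Context {R : realType} {n d : nat}.
Context (V : 'rV[R]_n -> R -> 'rV[R]_d -> R) (V_C1 : C1_xttau V).
Context (p : R -> 'rV[R]_d)
  (p_derivable : forall (i : 'I_d) (r : R), derivable (fun s => p s 0 i) r 1).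
Context (E dE : R -> R) (alpha : R)
  (E_derive : forall t : R, 0 <= t -> is_derive t 1 E (dE t)).

Let W x t := expR (E t) * V x t (p (t / alpha)).

(** The derivative of [W] along a curve passing through [x] at time [t] with velocity [v]; [v = 0]
    gives the partial derivative in time. *)
Definition weighted_rate (x : 'rV[R]_n) (t : R) (v : 'rV[R]_n) : R :=
  let tau := p (t / alpha) in
  expR (E t) * (dE t * V x t tau + (partial_t V x t tau + dotv (partial_x V x t tau) v
    + dotv (partial_tau V x t tau) (alpha^-1 *: curve_deriv p (t / alpha)))).

Lemma weighted_chain_rule (a t : R) (x : R -> 'rV[R]_n) v : 0 <= a -> a <= t ->
  has_derive_from a x t v ->
  has_derive_from a (fun s => W (x s) s) t (weighted_rate (x t) t v).
Proof.
move=> a0 at_ dx; have t0 : 0 <= t by exact: le_trans at_.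
rewrite /weighted_rate mulrDr mulrA.
apply: has_derive_fromM.
  apply: is_derive_has_derive_from.
  exact: (is_derive1_comp (is_derive_expR (E t)) (E_derive t0)).
apply: (C1_chain_rule V_C1 a0 at_ dx (tau := fun s => p (s / alpha))).
by apply: has_derive_from_widen a0 _; exact: curve_rescaled_derive.
Qed.

Lemma weighted_deriv_t x (t : R) : 0 <= t ->
  has_derive_from 0 (W x) t (weighted_rate x t 0).
Proof.
move=> t0; have := @weighted_chain_rule 0 t (fun=> x) 0 (lexx 0) t0; apply.
apply/has_derive_fromP => e e0; exists 1 => // s _ _.
by rewrite subrr scaler0 subr0 normr0 mulr_ge0// ltW.
Qed.

Lemma weighted_partials x (t : R) : 0 <= t ->
  has_partials (fun y => W y t) x.
Proof.
move=> t0 i; have [dV _ _ _] := V_C1; have [dVx _ _] := dV x t (p (t / alpha)) t0.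
exact: (derivableZ (k := expR (E t)) (dVx i)).
Qed.

Lemma weighted_grad_x x (t : R) : 0 <= t ->
  grad_x W x t = expR (E t) *: partial_x V x t (p (t / alpha)).
Proof.
move=> t0; have [dV _ _ _] := V_C1; have [dVx _ _] := dV x t (p (t / alpha)) t0.
apply/rowP => i; rewrite [LHS]mxE [RHS]mxE [in RHS]mxE.
exact: (deriveZ (expR (E t)) (dVx i)).
Qed.

(** The rate is affine in the velocity. This converts the bound along trajectories into the
    inequality on partial derivatives required of a Lyapunov function. *)
Lemma weighted_rate_grad x (t : R) v : 0 <= t ->
  weighted_rate x t v = weighted_rate x t 0 + dotv (grad_x W x t) v.
Proof.
move=> t0; rewrite weighted_grad_x// /weighted_rate.
have -> : dotv (partial_x V x t (p (t / alpha))) 0 = 0.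
  by rewrite -(scale0r (0 : 'rV[R]_n)) dotvZ mul0r.
have -> : dotv (expR (E t) *: partial_x V x t (p (t / alpha))) v =
    expR (E t) * dotv (partial_x V x t (p (t / alpha))) v.
  exact: dotvZl.
ring.
Qed.

Lemma weighted_C1 : continuous (curve_deriv p) -> {within `[0, +oo[, continuous dE} ->
  C1_xt W.
Proof.
move=> cp cdE; have [dV cVx cVt cVtau] := V_C1.
pose D := [set z : 'rV[R]_n * R | 0 <= z.2].
(* Continuity of every partial of [V] is pulled back along this continuous map. *)
pose j (z : 'rV[R]_n * R) := (z.1, z.2, p (z.2 / alpha)).
have c_p : continuous p by exact: curve_continuous.
have cscale : continuous (fun z : 'rV[R]_n * R => z.2 / alpha).
  by move=> z; apply: cvgM; [exact: cvg_snd|exact: cvg_cst].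
have cj : {within D, continuous j}.
  apply: continuous_subspaceT => z.
  apply: (@cvg_pair _ _ _ _ (nbhs (z.1, z.2)) (nbhs (p (z.2 / alpha)))).
    by apply: (@cvg_pair _ _ _ _ (nbhs z.1) (nbhs z.2)); [exact: cvg_fst|exact: cvg_snd].
  exact: (cvg_comp _ _ (cscale z) (c_p (z.2 / alpha))).
have lift (U : topologicalType) (G : 'rV[R]_n * R * 'rV[R]_d -> U) :
    {within [set z : 'rV[R]_n * R * 'rV[R]_d | 0 <= z.1.2], continuous G} ->
    {within D, continuous (G \o j)}.
  by apply: continuous_comp_within.
have lift_t (h : R -> R) : {within `[0, +oo[, continuous h} ->
    {within D, continuous (h \o snd)}.
  move=> ch; refine (@continuous_comp_within ('rV[R]_n * R)%type R R D _ snd h _ _ ch).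
    by apply: continuous_subspaceT => z; exact: cvg_snd.
  by move=> z; rewrite /D /= in_itv /= andbT.
have cE : {within D, continuous (expR \o (E \o snd))}.
  have cE0 : {within `[0, +oo[, continuous E}.
    apply: continuous_in_subspaceT => t; rewrite inE /= in_itv /= andbT => t0.
    have [dEt _] := E_derive t0.
    by move/derivable1_diffP: dEt => /differentiable_continuous.
  apply/subspace_continuousP => z Dz.
  have /subspace_continuousP/(_ _ Dz) h := lift_t _ cE0.
  exact: (cvg_comp _ _ h (@continuous_expR R _)).
split.
- move=> x t t0; split; first exact: weighted_partials.
  exact: has_derive_from_derivable (@weighted_deriv_t x t t0).
- apply: (@subspace_eq_continuous _ D _
    (fun z => expR (E z.2) *: partial_x V z.1 z.2 (p (z.2 / alpha)))).
    by move=> z; rewrite inE => Dz; apply/esym; exact: weighted_grad_x.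
  apply/subspace_continuousP => z Dz; apply: cvgZ.
    by move/subspace_continuousP: cE; apply.
  by move/subspace_continuousP: (lift _ _ cVx); apply.
(* The time partial is the rate at zero velocity; continuity of [curve_deriv p] enters through its
   last term. *)
- apply: (@subspace_eq_continuous _ D _ (fun z => weighted_rate z.1 z.2 0)).
    move=> z; rewrite inE => Dz; apply/esym.
    exact: (has_derive_from_unique Dz (@weighted_deriv_t _ _ Dz)).
  apply/subspace_continuousP => z Dz; apply: cvgM.
    by move/subspace_continuousP: cE; apply.
  apply: cvgD.
    apply: cvgM; first by move/subspace_continuousP: (lift_t _ cdE); apply.
    by move/subspace_continuousP: (lift _ _ (C1_within_continuous V_C1)); apply.
  apply: cvgD; first apply: cvgD.
  + by move/subspace_continuousP: (lift _ _ cVt); apply.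
  + apply: cvg_dotv; last exact: cvg_cst.
    by move/subspace_continuousP: (lift _ _ cVx); apply.
  + apply: cvg_dotv; first by move/subspace_continuousP: (lift _ _ cVtau); apply.
    apply: cvgZ; first exact: cvg_cst.
    have h : continuous (fun z : 'rV[R]_n * R => curve_deriv p (z.2 / alpha)).
      by move=> y; exact: (cvg_comp _ _ (cscale y) (cp (y.2 / alpha))).
    have hD : {within D, continuous
        (fun z : 'rV[R]_n * R => curve_deriv p (z.2 / alpha))}.
      exact: continuous_subspaceT.
    by move/subspace_continuousP: hD; apply.
Qed.
End WeightedFunction.

(** * Stability and the Lyapunov property *)

Unset Implicit Arguments.

Theorem theorem6 (R : realType) (n d : nat)
    (f : 'rV[R]_n -> R -> 'rV[R]_d -> 'rV[R]_n) (p : R -> 'rV[R]_d)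
    (p_bounded : exists M : R, forall r, enorm (p r) <= M)
    (p_derivable : forall (i : 'I_d) (r : R), derivable (fun s => p s 0 i) r 1)
    (dp_bounded : forall i : 'I_d, exists M : R, forall r,
       `|curve_deriv p r 0 i| <= M)
    (standing_p : forall alpha : R, 0 < alpha ->
       standing (fun x t => f x t (p (t / alpha))))
    (standing_tau : forall tau, range p tau -> standing (fun x t => f x t tau))
    (alpha1 alpha2 : R -> R) (ca cb T : R) (q : 'rV[R]_d -> R)
    (V : 'rV[R]_n -> R -> 'rV[R]_d -> R)
    (alpha1_Kinfty : Kinfty alpha1) (alpha2_Kinfty : Kinfty alpha2)
    (ca_gt0 : 0 < ca) (cb_gt0 : 0 < cb) (T_gt0 : 0 < T)
    (q_continuous : continuous q)
    (V_C1 : C1_xttau V)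
    (V_ge0 : forall x (t : R) tau, 0 <= t -> 0 <= V x t tau)
    (V_bounds : forall x (t : R) tau, 0 <= t -> range p tau ->
       alpha1 (enorm x) <= V x t tau <= alpha2 (enorm x))
    (V_decay : forall x (t : R) tau, 0 <= t -> range p tau ->
       partial_t V x t tau + dotv (partial_x V x t tau) (f x t tau)
         <= - q tau * V x t tau)
    (V_tau : forall x (t : R) tau, 0 <= t -> range p tau ->
       enorm (partial_tau V x t tau) <= ca * V x t tau)
    (q_mean : forall t : R, 0 <= t ->
       cb <= \int[@lebesgue_measure R]_(s in `[t - T, t]) q (p s)) :
  let pbar := sup (range (fun r => enorm (curve_deriv p r))) in
  forall alpha : R, 0 < alpha -> 2 * T * ca * pbar / cb < alpha ->
    UGAS (fun x t => f x t (p (t / alpha))) /\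
    (continuous (curve_deriv p) ->
     Lyapunov (fun x t => f x t (p (t / alpha))) (Vsharp p q V T alpha)).
Proof.
move=> pbar alpha alpha0 alpha_large.
have [M qM] := continuous_bounded_along q_continuous p_bounded.
have c_qp : continuous (fun r => q (p r)).
  have c_p : continuous p by exact: curve_continuous.
  by move=> r; exact: (cvg_comp _ _ (c_p r) (q_continuous (p r))).
have [dE [K [E_derive E_bound dE_cont dE_le]]] :=
  window_exponent_derive c_qp qM T_gt0 alpha0 q_mean.
set E := window_exponent _ _ _ in E_derive E_bound.
pose W := Vsharp p q V T alpha.
pose h := fun x t => f x t (p (t / alpha)).
(* Half of the averaged decay rate [cb / T]; the other half absorbs the drift of [p]. *)
pose c := cb / (2 * T).
have c0 : 0 < c by rewrite divr_gt0// mulr_gt0.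
have in_range t : range p (p (t / alpha)) by exists (t / alpha).
have pbar_ge r : enorm (curve_deriv p r) <= pbar.
  exact: curve_deriv_le_sup dp_bounded.
have pbar0 : 0 <= pbar by apply: le_trans (pbar_ge 0); exact: enorm_ge0.
(* The lower bound on [alpha], rearranged. *)
have gain : alpha^-1 * (ca * pbar) <= c.
  rewrite mulrC ler_pdivrMr// -ler_pdivrMl//; apply: ltW.
  apply: le_lt_trans alpha_large; rewrite le_eqVlt; apply/orP; left; apply/eqP.
  by rewrite /c; field; rewrite !gt_eqF.
(* Once the exponential is factored out, [q tau] from [dE] cancels [- q tau] from [V_decay]; what
   remains is at most [- cb / T + c], that is [- c], times [V]. *)
have rate_le x (t : R) : 0 <= t ->
    weighted_rate V p E dE alpha x t (h x t) <= - c * W x t.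
  move=> t0; have -> : W x t = expR (E t) * V x t (p (t / alpha)) by [].
  rewrite /weighted_rate mulrCA ler_pM2l ?expR_gt0//.
  set tau := p (t / alpha); set v := V x t tau.
  have v0 : 0 <= v by exact: V_ge0.
  have le_dE : dE t * v <= (q tau - cb / T) * v.
    by apply: ler_wpM2r => //; exact: dE_le.
  have le_V := V_decay x t tau t0 (in_range t).
  have le_tau : dotv (partial_tau V x t tau) (alpha^-1 *: curve_deriv p (t / alpha))
      <= c * v.
    apply: (@le_trans _ _ (alpha^-1 * (ca * pbar) * v)); last exact: ler_wpM2r.
    rewrite dotvZ -mulrA ler_pM2l ?invr_gt0//.
    apply: le_trans (dotv_le_enorm _ _) _; rewrite mulrAC.
    apply: ler_pM => //; [exact: enorm_ge0|exact: enorm_ge0|].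
    exact: V_tau (in_range t).
  have cT : cb / T * v = c * v + c * v by rewrite /c; field; rewrite gt_eqF.
  rewrite -/(h x t) in le_V; rewrite mulrBl cT in le_dE.
  move: le_dE le_V le_tau; rewrite /v /h -/tau mulNr; lra.
have expR_le (t : R) : 0 <= t -> expR (- K) <= expR (E t) <= expR K.
  by move=> t0; rewrite !ler_expR -ler_norml; exact: E_bound.
have W_bounds x (t : R) : 0 <= t ->
    expR (- K) * alpha1 (enorm x) <= W x t <= expR K * alpha2 (enorm x).
  move=> t0; have /andP[E1 E2] := expR_le t t0.
  have /andP[V1 V2] := V_bounds x t _ t0 (in_range t).
  have a1 : 0 <= alpha1 (enorm x) by apply: Kinfty_ge0 => //; exact: enorm_ge0.
  by apply/andP; split; apply: ler_pM; rewrite ?expR_ge0// V_ge0.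
split.
  (* One factor [expR K] comes from the upper bound on [W], the other from inverting [expR (- K)] in
     the lower bound. *)
  have C0 : 0 < expR K * expR K by rewrite mulr_gt0 ?expR_gt0.
  have [beta KLbeta beta_ge] := KL_exp_decay alpha1_Kinfty alpha2_Kinfty C0 c0.
  exists beta => // x0 t0 phi t00 [phi0 dphi] t t0t.
  apply: beta_ge; [exact: enorm_ge0|exact: enorm_ge0|].
  have dW r : t0 <= r -> has_derive_from t0 (fun s => W (phi s) s) r
      (weighted_rate V p E dE alpha (phi r) r (h (phi r) r)).
    by move=> t0r; apply: weighted_chain_rule => //; exact: dphi.
  have := exp_decay_from t0t dW (fun r t0r => rate_le _ _ (le_trans t00 t0r)).
  rewrite phi0 => decay.
  have /andP[W1 _] := W_bounds (phi t) t (le_trans t00 t0t).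
  have /andP[_ W2] := W_bounds x0 t0 t00.
  have : expR (- K) * alpha1 (enorm (phi t)) <=
      expR (- c * (t - t0)) * (expR K * alpha2 (enorm x0)).
    apply: le_trans W1 (le_trans decay _).
    by rewrite ler_pM2l ?expR_gt0.
  rewrite expRN mulrC ler_pdivrMr ?expR_gt0// => le1.
  by apply: le_trans le1 _; rewrite le_eqVlt; apply/orP; left; apply/eqP; ring.
move=> cdp; split.
- have WE : Vsharp p q V T alpha =
      fun x t => expR (E t) * V x t (p (t / alpha)) by [].
  rewrite WE; exact: (@weighted_C1 _ _ _ V V_C1 p p_derivable E dE alpha
    E_derive cdp dE_cont).
- by move=> x t t0; rewrite mulr_ge0 ?expR_ge0// V_ge0.
(* The third function is [c] times the lower bound on [W], so decay at rate [c * W] dominates it. *)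
exists (fun s => expR (- K) * alpha1 s), (fun s => expR K * alpha2 s),
  (fun s => c * (expR (- K) * alpha1 s)); split.
- by apply: Kinfty_scale => //; exact: expR_gt0.
- by apply: Kinfty_scale => //; exact: expR_gt0.
- apply: Kinfty_posdef; apply: Kinfty_scale => //; apply: Kinfty_scale => //.
  exact: expR_gt0.
- move=> x t t0; split; first exact: W_bounds.
  have dWt := @weighted_deriv_t _ _ _ V V_C1 p p_derivable E dE alpha
    E_derive x t t0.
  rewrite /deriv_t (has_derive_from_unique t0 dWt).
  have := rate_le x t t0.
  rewrite (@weighted_rate_grad _ _ _ V V_C1 p E dE alpha x t (h x t) t0) => le1.
  apply: le_trans le1 _; rewrite mulNr lerN2 ler_pM2l//.
  by have /andP[] := W_bounds x t t0.
Qed.
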